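(* Let $\kappa\in\mathbb{Z}_{\ge0}^n$. The inclusion $\iota_\kappa$ of the poset of $\kappa$-caged M-convex sets on $[n]$ into the poset of all M-convex sets on $[n]$ (both with the weak-map order $\preceq$) and the $\kappa$-retraction $\mathrm{Ret}_\kappa$ form a Galois connection $\iota_\kappa\dashv\mathrm{Ret}_\kappa$: for every $\kappa$-caged M-convex set $K$ on $[n]$ and every M-convex set $J$ on $[n]$, $$K\preceq J\iff K\preceq \mathrm{Ret}_\kappa(J).$$ Equivalently, for every M-convex set $J$ on $[n]$, $\mathrm{Ret}_\kappa(J)$ is the greatest $\kappa$-caged M-convex set $K$ on $[n]$ satisfying $K\preceq J$.
   Context: Let $[n]=\{1,\dots,n\}$, let $e_i$ be the $i$-th standard basis vector, and order $\mathbb{Z}^n$ coordinatewise. A nonempty set $J\subseteq\{\alpha\in\mathbb{Z}_{\ge0}^n:\alpha_1+\cdots+\alpha_n=r\}$ is an M-convex set of rank $r$ on $[n]$ if for all $\alpha,\beta\in J$ and $i\in[n]$ with $\alpha_i<\beta_i$ there is $j\in[n]$ with $\alpha_j>\beta_j$ such that $\alpha+e_i-e_j\in J$ and $\beta-e_i+e_j\in J$. $J$ is $\kappa$-caged if $\alpha\le\kappa$ for all $\alpha\in J$. Weak-map order: for M-convex sets $J_1,J_2$ on $[n]$ (ranks may differ), $J_2\preceq J_1$ means that for every $\alpha\in J_2$ there is $\beta\in J_1$ with $\alpha\le\beta$. This is a partial order on M-convex sets on $[n]$. $\mathrm{proj}_\kappa(v)_i=\min(v_i,\kappa_i)$, and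 $\mathrm{Ret}_\kappa(J)$ is the set of coordinatewise maximal elements of $\mathrm{proj}_\kappa(J)=\{\mathrm{proj}_\kappa(\alpha):\alpha\in J\}$; it is a $\kappa$-caged M-convex set. Maps $L\colon P\to Q$, $R\colon Q\to P$ of posets form a Galois connection $L\dashv R$ if $L(p)\le q\iff p\le R(q)$ for all $p\in P$, $q\in Q$. *)

(* Defs.v *)
From HB Require Import structures.
From mathcomp Require Import all_boot all_order.
From mathcomp Require Import boolp classical_sets.
From mathcomp Require Import zify.

Set Implicit Arguments.
Unset Strict Implicit.
Unset Printing Implicit Defensive.

Import Order.TTheory.

Local Open Scope classical_set_scope.
Local Open Scope nat_scope.

(* The order [(a <= b)%O] on [vec n] is the pointwise one from [boolp]. *)
Definition vec (n : nat) : Type := 'I_n -> nat.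

Definition size_vec n (a : vec n) : nat := \sum_(i < n) a i.

(* [exch i j a] is a + e_i - e_j.  In [is_mconvex] it is only applied with
   i != j and 0 < a j, so the truncated subtraction is exact. *)
Definition exch n (i j : 'I_n) (a : vec n) : vec n :=
  fun k => a k + (k == i) - (k == j).

Definition is_mconvex n (r : nat) (J : set (vec n)) : Prop :=
  [/\ J !=set0,
      (forall a, J a -> size_vec a = r) &
      forall a b i, J a -> J b -> a i < b i ->
        exists j, [/\ b j < a j, J (exch i j a) & J (exch j i b)]].

Definition is_caged n (kappa : vec n) (J : set (vec n)) : Prop :=
  forall a, J a -> (a <= kappa)%O.

Definition weak_map_le n (J2 J1 : set (vec n)) : Prop :=
  forall a, J2 a -> exists2 b, J1 b & (a <= b)%O.

Definition proj n (kappa v : vec n) : vec n := fun i => minn (v i) (kappa i).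

Definition maximals n (A : set (vec n)) : set (vec n) :=
  [set x | A x /\ forall y, A y -> (x <= y)%O -> y = x].

Definition Ret_set n (kappa : vec n) (J : set (vec n)) : set (vec n) :=
  maximals (proj kappa @` J).

Record mconvex (n : nat) : Type := MConvex {
  mconvex_set :> set (vec n);
  _ : `[< exists r, is_mconvex r mconvex_set >] }.

HB.instance Definition _ n := [isSub for @mconvex_set n].
HB.instance Definition _ n := [Choice of mconvex n by <:].

Lemma vec_leP n (a b : vec n) : reflect (forall i, a i <= b i) (a <= b)%O.
Proof. by apply: (iffP (lefP a b)) => H i; apply: H. Qed.

Lemma mconvexP n (J : mconvex n) : exists r, is_mconvex r J.
Proof. by case: J => J HJ; apply/asboolP. Qed.

Lemma size_vec_le n (a b : vec n) : (a <= b)%O -> size_vec a <= size_vec b.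
Proof. by move=> /vec_leP H; apply: leq_sum => i _; apply: H. Qed.

Lemma size_vec_le_eq n (a b : vec n) :
  (a <= b)%O -> size_vec b <= size_vec a -> b = a.
Proof.
move=> /vec_leP H Hs; apply/funext => i; apply/eqP.
rewrite eqn_leq H andbT leqNgt; apply/negP => Hi.
suff : size_vec a < size_vec b by rewrite ltnNge Hs.
rewrite /size_vec (bigD1 i) //= [X in _ < X](bigD1 i) //= -addSn.
by apply: leq_add => //; apply: leq_sum => j _; apply: H.
Qed.

Definition mconvex_le n (K J : mconvex n) : bool := `[< weak_map_le K J >].

Lemma mconvex_le_refl n : reflexive (@mconvex_le n).
Proof. by move=> J; apply/asboolP => a Ja; exists a. Qed.

Lemma mconvex_le_anti n : antisymmetric (@mconvex_le n).
Proof.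
move=> J K /andP[/asboolP JK /asboolP KJ]; apply: val_inj => /=.
have sub (A B : mconvex n) : weak_map_le A B -> weak_map_le B A ->
    mconvex_set A `<=` mconvex_set B.
  move=> AB BA a Aa; have [b Bb ab] := AB a Aa; have [c Ac bc] := BA b Bb.
  have [r [_ rA _]] := mconvexP A.
  suff <- : b = a by [].
  apply: size_vec_le_eq => //; rewrite (rA a Aa) -(rA c Ac).
  exact: size_vec_le.
by apply/seteqP; split; apply: sub.
Qed.

Lemma mconvex_le_trans n : transitive (@mconvex_le n).
Proof.
move=> K J L /asboolP JK /asboolP KL; apply/asboolP => a Ja.
have [b Kb ab] := JK a Ja; have [c Lc bc] := KL b Kb.
by exists c => //; apply: le_trans bc.
Qed.

Fact weak_map_display : Order.disp_t.
Proof. exact: (Order.Disp tt tt). Qed.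

HB.instance Definition _ n :=
  Order.Le_isPOrder.Build weak_map_display (mconvex n)
    (@mconvex_le_refl n) (@mconvex_le_anti n) (@mconvex_le_trans n).

Lemma mconvex_leP n (K J : mconvex n) : (K <= J)%O <-> weak_map_le K J.
Proof. by split=> [/asboolP|?] //; apply/asboolP. Qed.

Record caged n (kappa : vec n) : Type := Caged {
  caged_incl :> mconvex n;
  _ : `[< is_caged kappa caged_incl >] }.

HB.instance Definition _ n (kappa : vec n) := [isSub for @caged_incl n kappa].
HB.instance Definition _ n (kappa : vec n) := [Choice of caged kappa by <:].
HB.instance Definition _ n (kappa : vec n) :=
  [SubChoice_isSubPOrder of caged kappa by <: with weak_map_display].

Lemma caged_leP n (kappa : vec n) (K L : caged kappa) :
  (K <= L)%O <-> weak_map_le K L.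
Proof. exact: (mconvex_leP K L). Qed.

Lemma exists_max (T : Type) (A : set T) (f : T -> nat) (m : nat) :
  A !=set0 -> (forall x, A x -> f x <= m) ->
  exists2 x, A x & forall y, A y -> f y <= f x.
Proof.
move=> [x0 Ax0] Am.
have ex : exists k, `[< exists2 x, A x & f x = k >].
  by exists (f x0); apply/asboolP; exists x0.
have bd k : `[< exists2 x, A x & f x = k >] -> k <= m.
  by move=> /asboolP[x Ax <-]; apply: Am.
case: (ex_maxnP ex bd) => k /asboolP[x Ax <-] kmax.
by exists x => // y Ay; apply: kmax; apply/asboolP; exists y.
Qed.

Lemma size_vec_lt n (x y : vec n) :
  size_vec x < size_vec y -> exists i, x i < y i.
Proof.
move=> H; apply: contrapT => /forallNP Hn; move: H; rewrite ltnNge.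
by move=> /negP; apply; apply: leq_sum => i _; rewrite leqNgt; apply/negP/Hn.
Qed.

Lemma size_exch n (i j : 'I_n) (a : vec n) :
  i != j -> 0 < a j -> size_vec (exch i j a) = size_vec a.
Proof.
move=> ij aj; rewrite /size_vec (bigD1 i) // (bigD1 j) 1?eq_sym //=.
rewrite [RHS](bigD1 i) // [in RHS](bigD1 j) 1?eq_sym //= /exch !eqxx.
rewrite (negPf ij) [j == i]eq_sym (negPf ij).
rewrite (eq_bigr a); first by lia.
by move=> k /andP[/negPf-> /negPf->]; rewrite addn0 subn0.
Qed.

Section Retraction.
Variables (n : nat) (kappa : vec n) (J : set (vec n)) (r : nat).
Hypothesis HJ : is_mconvex r J.

Lemma proj_exch_up (a : vec n) (i j : 'I_n) : i != j ->
  a i < kappa i -> kappa j < a j ->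
  (proj kappa a <= proj kappa (exch i j a))%O /\
  proj kappa (exch i j a) <> proj kappa a.
Proof.
move=> ij ai aj; split.
  apply/vec_leP => k; rewrite /proj /exch.
  have [->|_] := eqVneq k i; first by rewrite (negPf ij); lia.
  by have [->|_] := eqVneq k j; lia.
move=> /(congr1 (@^~ i)); rewrite /proj /exch eqxx (negPf ij); lia.
Qed.

Lemma proj_exch (a : vec n) (i j : 'I_n) : i != j ->
  a i < kappa i -> a j <= kappa j ->
  proj kappa (exch i j a) = exch i j (proj kappa a).
Proof.
move=> ij ai aj; apply/funext => k; rewrite /proj /exch.
have [->|_] := eqVneq k i; first by rewrite (negPf ij); lia.
by have [->|_] := eqVneq k j; lia.
Qed.

Lemma maximal_proj (a b : vec n) : J a -> J b ->
  maximals (proj kappa @` J) (proj kappa a) ->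
  (proj kappa a <= proj kappa b)%O -> proj kappa b = proj kappa a.
Proof. by move=> Ja Jb [_]; apply; exists b. Qed.

Lemma Ret_size_max (a b : vec n) : J a -> J b ->
  Ret_set kappa J (proj kappa a) ->
  size_vec (proj kappa b) <= size_vec (proj kappa a).
Proof.
move=> Ja Jb Ma; have [_ _ exJ] := HJ.
pose dist (b : vec n) := \sum_(i < n) (b i - a i).
have [m] := ubnP (dist b); elim: m b Jb => // m IH b Jb; rewrite ltnS => bm.
rewrite leqNgt; apply/negP => lt_ab; have [i] := size_vec_lt lt_ab.
rewrite /proj => abi; have [] := exJ a b i Ja Jb; first by lia.
move=> j [baj Ja' Jb'].
have ij : i != j by apply: contraTneq abi => ->; lia.
have [kj|kj] := ltnP (kappa j) (a j).
  have [|//|le_up] := @proj_exch_up a i j ij; first by lia.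
  by apply; apply: maximal_proj.
have : size_vec (proj kappa (exch j i b)) <= size_vec (proj kappa a).
  apply: IH => //; apply: leq_trans bm.
  rewrite /dist (bigD1 i) // [X in _ < X](bigD1 i) //= -addSn.
  apply: leq_add; first by rewrite /exch eqxx (negPf ij); lia.
  apply: leq_sum => k /negPf ki; rewrite /exch ki.
  by have [->|_] := eqVneq k j; lia.
apply/negP; rewrite -ltnNge; apply: leq_trans lt_ab _.
have [ki|ki] := ltnP (kappa i) (b i).
  apply: size_vec_le; have ji : j != i by rewrite eq_sym.
  by apply: (proj1 (proj_exch_up ji _ ki)); lia.
rewrite proj_exch ?[j == i]eq_sym //; last by lia.
by rewrite size_exch ?[j == i]eq_sym // /proj; lia.
Qed.

Lemma Ret_size_max_in (a b : vec n) : J a -> J b ->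
  Ret_set kappa J (proj kappa a) ->
  size_vec (proj kappa b) = size_vec (proj kappa a) ->
  Ret_set kappa J (proj kappa b).
Proof.
move=> Ja Jb Ma sab; split; first by exists b.
move=> _ [c Jc <-] bc; apply: size_vec_le_eq => //.
by rewrite sab; apply: Ret_size_max.
Qed.

Lemma Ret_set_mconvex : exists s, is_mconvex s (Ret_set kappa J).
Proof.
have [J0 rJ exJ] := HJ.
have [a Ja amax] : exists2 a, J a & forall b, J b ->
    size_vec (proj kappa b) <= size_vec (proj kappa a).
  apply: (@exists_max _ _ _ r) => // b Jb; rewrite -(rJ b Jb).
  by apply: size_vec_le; apply/vec_leP => i; apply: geq_minl.
have Ma : Ret_set kappa J (proj kappa a).
  split; first by exists a.
  by move=> _ [b Jb <-] ab; apply: size_vec_le_eq => //; apply: amax.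
exists (size_vec (proj kappa a)); split.
- by exists (proj kappa a).
- move=> x Mx; have [[b Jb bx] _] := Mx; subst x.
  by apply/eqP; rewrite eqn_leq !Ret_size_max.
clear a Ja amax Ma => x y i Mx My.
have [[a Ja ax] _] := Mx; have [[b Jb b_y] _] := My.
subst x y; rewrite /proj => abi.
have [] := exJ a b i Ja Jb; first by lia.
move=> j [baj Jx Jy].
have ij : i != j by apply: contraTneq abi => ->; lia.
have ji : j != i by rewrite eq_sym.
have kj : a j <= kappa j.
  rewrite leqNgt; apply/negP => kj.
  have [|//|le_up] := @proj_exch_up a i j ij; first by lia.
  by apply; apply: maximal_proj.
have ki : b i <= kappa i.
  rewrite leqNgt; apply/negP => ki.
  have [|//|le_up] := @proj_exch_up b j i ji; first by lia.
  by apply; apply: maximal_proj.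
exists j; split; first by lia.
- have <- : proj kappa (exch i j a) = exch i j (proj kappa a).
    by apply: proj_exch => //; lia.
  apply: (Ret_size_max_in Ja) => //.
  by rewrite proj_exch ?size_exch //; rewrite /proj; lia.
- have <- : proj kappa (exch j i b) = exch j i (proj kappa b).
    by apply: proj_exch => //; lia.
  apply: (Ret_size_max_in Jb) => //.
  by rewrite proj_exch ?size_exch //; rewrite /proj; lia.
Qed.

Lemma Ret_set_caged : is_caged kappa (Ret_set kappa J).
Proof.
by move=> _ [[a _ <-] _]; apply/vec_leP => i; apply: geq_minr.
Qed.

End Retraction.

Lemma Ret_mconvex_subproof n (kappa : vec n) (J : mconvex n) :
  `[< exists s, is_mconvex s (Ret_set kappa J) >].
Proof. by apply/asboolP; have [r] := mconvexP J; apply: Ret_set_mconvex. Qed.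

Lemma Ret_caged_subproof n (kappa : vec n) (J : mconvex n) :
  `[< is_caged kappa (MConvex (Ret_mconvex_subproof kappa J)) >].
Proof. by apply/asboolP; apply: Ret_set_caged. Qed.

Definition Ret n (kappa : vec n) (J : mconvex n) : caged kappa :=
  Caged (Ret_caged_subproof kappa J).

Definition galois_connection d1 d2 (P : porderType d1) (Q : porderType d2)
    (L : P -> Q) (R : Q -> P) : Prop :=
  forall p q, (L p <= q)%O <-> (p <= R q)%O.

Definition is_greatest d (P : porderType d) (A : set P) (m : P) : Prop :=
  A m /\ ubound A m.

(* Main.v *)
Require Import Defs.
From mathcomp Require Import all_boot all_order.
From mathcomp Require Import boolp classical_sets.

(** Projecting to the cage is a monotone map which never raises a vector and
    fixes those already in the cage.  So for a caged vector [a], lying below some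
    member [b] of [J] is the same as lying below some projection of a member:
    [a <= b] gives [a = proj kappa a <= proj kappa b], and conversely
    [proj kappa b <= b].  Passing from the projections to the maximal ones does
    not change what lies below them, because [kappa] bounds the total size and
    hence every projection is below a maximal one ([proj_le_Ret]).

    The resulting comparison ([weak_map_le_Ret]), read in the two posets, is the
    adjunction, and the greatest-element property is the usual description of
    the value of a right adjoint ([galois_greatest]). *)

Import Order.TTheory.
Local Open Scope classical_set_scope.

Section Projection.
Variables (n : nat) (kappa : vec n).

Lemma proj_le (v : vec n) : (proj kappa v <= v)%O.
Proof. by apply/vec_leP => i; apply: geq_minl. Qed.

Lemma proj_le_cage (v : vec n) : (proj kappa v <= kappa)%O.
Proof. by apply/vec_leP => i; apply: geq_minr. Qed.

Lemma le_proj (a b : vec n) :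
  (a <= kappa)%O -> (a <= b)%O -> (a <= proj kappa b)%O.
Proof.
move=> /vec_leP ak /vec_leP ab; apply/vec_leP => i.
by rewrite /proj leq_min ab ak.
Qed.

(** Among the projections above that of [b], one of largest total size exists,
    since total sizes are bounded by that of [kappa]; it is maximal, because a
    strictly larger vector has strictly larger size. *)
Lemma proj_le_Ret (J : set (vec n)) (b : vec n) :
  J b -> exists2 x, Ret_set kappa J x & (proj kappa b <= x)%O.
Proof.
move=> Jb.
have [||x [Px bx] xmax] := @exists_max _
    [set x | (proj kappa @` J) x /\ (proj kappa b <= x)%O]
    (@size_vec n) (size_vec kappa).
- by exists (proj kappa b); split=> //; exists b.
- by move=> _ [[c _ <-] _]; apply/size_vec_le/proj_le_cage.
exists x => //; split=> // y Py xy; apply: size_vec_le_eq => //.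
by apply: xmax; split=> //; apply: le_trans bx xy.
Qed.

Lemma weak_map_le_Ret (K J : set (vec n)) : is_caged kappa K ->
  weak_map_le K J <-> weak_map_le K (Ret_set kappa J).
Proof.
move=> cK; split=> KJ a Ka.
- have [b Jb ab] := KJ a Ka; have [x Rx bx] := proj_le_Ret _ _ Jb.
  by exists x => //; apply: le_trans bx; apply: le_proj (cK a Ka) ab.
- have [_ [[b Jb <-] _] ab] := KJ a Ka.
  by exists b => //; apply: le_trans ab (proj_le b).
Qed.

End Projection.

Lemma cagedP (n : nat) (kappa : vec n) (K : caged kappa) : is_caged kappa K.
Proof. by case: K => K cK; apply/asboolP. Qed.

(** A right adjoint sends [q] to the greatest [p] with [L p <= q]: the
    adjunction at [p = R q] puts [R q] in this set, and at any other [p] it says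
    that [R q] is an upper bound. *)
Lemma galois_greatest d1 d2 (P : porderType d1) (Q : porderType d2)
    (L : P -> Q) (R : Q -> P) (q : Q) :
  galois_connection L R -> is_greatest [set p | (L p <= q)%O] (R q).
Proof. by move=> LR; split=> [|p /LR //]; apply/LR. Qed.

Theorem theorem4p5 (n : nat) (kappa : vec n) :
  [/\ galois_connection (@caged_incl n kappa) (@Ret n kappa),
      forall (K : caged kappa) (J : mconvex n),
        weak_map_le K J <-> weak_map_le K (Ret_set kappa J) &
      forall J : mconvex n,
        is_greatest [set K : caged kappa | (caged_incl K <= J)%O]
          (Ret kappa J)].
Proof.
have comparison (K : caged kappa) (J : mconvex n) :
    weak_map_le K J <-> weak_map_le K (Ret_set kappa J).
  by apply: weak_map_le_Ret; apply: cagedP.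
have adj : galois_connection (@caged_incl n kappa) (@Ret n kappa).
  move=> K J; split.
  - by move=> /mconvex_leP /comparison KJ; apply/caged_leP.
  - by move=> /caged_leP KJ; apply/mconvex_leP/comparison.
by split=> // J; apply: galois_greatest adj.
Qed.
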